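(* Let $T$ be a tree. If $T$ is $(\iota,1)$-critical, then $T\in\mathcal{F}_\iota$.
   Context: For $D\subseteq V(T)$, $N[D]$ is $D$ with all neighbours; $D$ is isolating if $T-N[D]$ has no edges; $\iota(T)$ is the minimum size of an isolating set. $T_e$ is obtained by subdividing edge $e$ once. $T$ is $(\iota,1)$-critical if $\iota(T_e)>\iota(T)$ for every edge $e$ (and $T$ has an edge). The family $\mathcal{F}_\iota$ consists of trees $T$ for which there is a sequence $T_1,\dots,T_j$ ($j\ge1$) with $T_1=P_5$, $T_j=T$, each $T_{i+1}$ obtained from $T_i$ by one of the operations below, where each vertex carries a status $A$, $B$ or $C$ that, once assigned, never changes. In $T_1=P_5$ the middle vertex has status $A$, the two support vertices have status $B$, the two leaves have status $C$. Operation $\mathcal{O}_1$: add a new vertex $x$ and an edge $xy$ where $y$ has status $B$; the new vertex $x$ gets status $C$. Operation $\mathcal{O}_2$: add a path $u v$ and an edge $xu$ where $x$ has status $A$; $u$ gets status $B$ and $v$ gets status $C$. Operation $\mathcal{O}_3$: add a path $u v w z$ and an edge $xu$ where $x$ has status $C$; $u,v,w,z$ get statuses $B,A,B,C$ respectively. *)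

(* Defs.v *)
From mathcomp Require Import all_boot.

Set Implicit Arguments.
Unset Strict Implicit.
Unset Printing Implicit Defensive.

(** A graph is a relation [e : rel T] on a finite type; [is_tree] includes the
    requirement that [e] is a simple graph. *)

Definition path_graph (n : nat) : rel 'I_n :=
  fun i j => (i.+1 == j) || (j.+1 == i).

Section Graphs.
Variables (T : finType) (e : rel T).

Definition connected_graph : Prop :=
  0 < #|T| /\ forall x y : T, connect e x y.

Definition acyclic_graph : Prop :=
  forall c : seq T, uniq c -> 2 < size c -> ~~ cycle e c.

Definition is_tree : Prop :=
  [/\ symmetric e, irreflexive e, connected_graph & acyclic_graph].

Definition closed_nbh (D : {set T}) : {set T} :=
  D :|: [set v | [exists u in D, e u v]].

Definition isolating (D : {set T}) : bool :=
  [forall u, forall v,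
    (u \notin closed_nbh D) && (v \notin closed_nbh D) ==> ~~ e u v].

(** The default [[set: T]] of [arg min] is always isolating. *)
Definition iota_num : nat :=
  #|[arg min_(D < [set: T] | isolating D) #|D|]|.

(** Subdivision of the edge [ab]; the new vertex is [None]. *)
Definition subdivide (a b : T) : rel (option T) := fun p q =>
  match p, q with
  | Some u, Some v =>
      e u v && ~~ ((u == a) && (v == b) || (u == b) && (v == a))
  | None, Some u | Some u, None => (u == a) || (u == b)
  | None, None => false
  end.

(** Disjoint union of [e] and a path on [k] vertices, plus an edge joining [x]
    to the first vertex of that path. *)
Definition attach_path (k : nat) (x : T) : rel (T + 'I_k) := fun p q =>
  match p, q with
  | inl u, inl v => e u v
  | inr i, inr j => path_graph i j
  | inl u, inr i | inr i, inl u => (u == x) && (i == 0 :> nat)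
  end.

End Graphs.

Definition critical (T : finType) (e : rel T) : Prop :=
  (exists a b : T, e a b) /\
  (forall a b : T, e a b -> iota_num e < iota_num (subdivide e a b)).

Inductive status : Type := stA | stB | stC.

(** Existing vertices keep their status, and the [i]-th vertex of the attached
    path gets the [i]-th status of [s]; the default of [nth] is never reached
    when [size s = k]. *)
Definition attach_status (T : finType) (st : T -> status) (k : nat)
    (s : seq status) : T + 'I_k -> status := fun p =>
  match p with
  | inl u => st u
  | inr i => nth stC s i
  end.

(** [built e st]: the graph [e] with statuses [st] is the last term of a
    construction sequence. Graphs are taken up to status-preserving isomorphism,
    whence [built_iso]. *)
Inductive built : forall T : finType, rel T -> (T -> status) -> Prop :=
| built_P5 :
    built (@path_graph 5)
      (fun i : 'I_5 => nth stC [:: stC; stB; stA; stB; stC] i)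
| built_O1 (T : finType) (e : rel T) (st : T -> status) (y : T) :
    built e st -> st y = stB ->
    built (@attach_path T e 1 y) (@attach_status T st 1 [:: stC])
| built_O2 (T : finType) (e : rel T) (st : T -> status) (x : T) :
    built e st -> st x = stA ->
    built (@attach_path T e 2 x) (@attach_status T st 2 [:: stB; stC])
| built_O3 (T : finType) (e : rel T) (st : T -> status) (x : T) :
    built e st -> st x = stC ->
    built (@attach_path T e 4 x)
      (@attach_status T st 4 [:: stB; stA; stB; stC])
| built_iso (T T' : finType) (e : rel T) (e' : rel T')
    (st : T -> status) (st' : T' -> status) (f : T -> T') :
    built e st -> bijective f ->
    (forall u v, e' (f u) (f v) = e u v) -> (forall u, st' (f u) = st u) ->
    built e' st'.

Definition family_iota (T : finType) (e : rel T) : Prop :=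
  exists st : T -> status, built e st.

(* Main.v *)
Require Import Defs.
From mathcomp Require Import all_boot.

(** Let [D] be a minimum isolating set of a critical tree; label [D] by A, its
    other dominated vertices by B and the rest by C. If subdividing an edge left
    [D] isolating, the edge would not be critical; this forces every edge to join
    A to B or B to C, and every B to have exactly one A-neighbour and at least
    one C-neighbour. Every A has two neighbours, since a leaf in [D] could be
    exchanged for its neighbour. Conversely a tree with such a labelling can be
    grown from a [P5] centred at an A: a vertex outside the connected part built
    so far has only one neighbour in it, so the missing vertices demanded by the
    labelling lie outside that part and form the path required by [O1], [O2] or
    [O3]. *)

Set Implicit Arguments.
Unset Strict Implicit.
Unset Printing Implicit Defensive.

(** * Isolating sets and the isolation number *)

Section Domination.
Variables (T : finType) (e : rel T).

Lemma closed_nbhP (D : {set T}) (v : T) :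
  reflect (v \in D \/ exists2 u, u \in D & e u v) (v \in closed_nbh e D).
Proof.
rewrite in_setU inE; apply: (iffP orP) => -[vD|].
- by left.
- by case/existsP=> u /andP[uD euv]; right; exists u.
- by left.
- by case=> u uD euv; right; apply/existsP; exists u; rewrite uD.
Qed.

Lemma isolatingP (D : {set T}) :
  reflect (forall u v, e u v -> u \notin closed_nbh e D -> v \in closed_nbh e D)
          (isolating e D).
Proof.
apply: (iffP forallP) => [isoD u v euv uN | isoD u].
  apply/negPn/negP => vN; move/forallP/(_ v): (isoD u).
  by rewrite uN vN euv.
apply/forallP=> v; apply/implyP=> /andP[uN vN]; apply/negP=> euv.
by rewrite (isoD u v) in vN.
Qed.

Lemma isolatingT : isolating e [set: T].
Proof. by apply/isolatingP=> u v _ _; apply/closed_nbhP; left; rewrite inE. Qed.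

Lemma iota_num_le (D : {set T}) : isolating e D -> iota_num e <= #|D|.
Proof.
rewrite /iota_num => isoD.
by case: arg_minnP => [|D0 _ minD]; [exact: isolatingT | exact: minD].
Qed.

Definition min_isolating (D : {set T}) : Prop :=
  isolating e D /\ #|D| = iota_num e.

Lemma min_isolating_exists : exists D, min_isolating D.
Proof.
exists [arg min_(D < [set: T] | isolating e D) #|D|]; split=> //.
by case: arg_minnP => //; exact: isolatingT.
Qed.

Lemma isolating_not_set0 (D : {set T}) a b :
  isolating e D -> e a b -> exists d, d \in D.
Proof.
move=> /isolatingP isoD eab.
have [/closed_nbhP[aD|[d dD _]]|/(isoD a b eab)/closed_nbhP[bD|[d dD _]]] :=
  boolP (a \in closed_nbh e D); by [exists a | exists b | exists d].
Qed.

End Domination.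

(** * Minimum isolating sets of a critical graph *)

Section Critical.
Variables (T : finType) (e : rel T).
Hypotheses (e_sym : symmetric e) (e_irr : irreflexive e).
Hypothesis e_conn : connected_graph e.
Hypothesis e_crit : critical e.

(** Here subdividing [ab] uncovers an edge: [b] loses its only dominator, so [bc] joins two
    undominated vertices. *)
Definition private_pair (D : {set T}) (a b : T) : Prop :=
  [/\ a \in D, b \notin D, forall d, d \in D -> e d b -> d = a
    & exists2 c, e b c & c \notin closed_nbh e D].

Lemma nbr_neq u v : e u v -> u != v.
Proof. by apply: contraTneq => ->; rewrite e_irr. Qed.

(* A minimum isolating set of [e] cannot remain isolating once [ab] is
   subdivided; an uncovered edge of the subdivision avoids the new vertex in the
   last two cases and contains it in the first. *)
Lemma critical_edge (D : {set T}) (a b : T) :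
  min_isolating e D -> e a b ->
  [\/ [/\ a \notin D, b \notin D &
          a \notin closed_nbh e D \/ b \notin closed_nbh e D],
      private_pair D a b | private_pair D b a].
Proof.
case=> isoD cardD eab; have [_ /(_ a b eab)] := e_crit.
set e' := subdivide e a b; set D' := Some @: D => lt_iota.
have D'E u : (Some u \in D') = (u \in D).
  by rewrite mem_imset //; exact: Some_inj.
have e'_sym : symmetric e'.
  move=> [u|] [v|] //=; rewrite e_sym.
  by rewrite orbC [(v == b) && _]andbC [(v == a) && _]andbC.
(* A vertex undominated after the subdivision can only have been dominated across the lost edge
   [ab]. *)
have dom u : Some u \notin closed_nbh e' D' ->
    u \notin D /\ (forall d, d \in D -> e d u -> (d, u) = (a, b) \/ (d, u) = (b, a)).
  move=> uN'; have uD : u \notin D.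
    by apply: contra uN' => uD; apply/closed_nbhP; left; rewrite D'E.
  split=> // d dD edu; move: uN'.
  case E: (e' (Some d) (Some u)).
    by case/closed_nbhP; right; exists (Some d); rewrite ?D'E.
  move: E; rewrite /= edu /= => /negbFE /orP[]/andP[/eqP-> /eqP->] _; by [left|right].
(* An uncovered old edge [uv]. If both ends were dominated in [e], then only across [ab], so [uv]
   would be [ab] itself, which is no longer an edge. Hence [v] is the undominated neighbour required
   by the private pair. *)
have main u v : e u v -> e' (Some u) (Some v) ->
    Some u \notin closed_nbh e' D' -> Some v \notin closed_nbh e' D' ->
    u \in closed_nbh e D -> private_pair D a b \/ private_pair D b a.
  move=> euv e'uv uN' vN' uN; have [uD nbu] := dom u uN'.
  have vN : v \notin closed_nbh e D.
    apply/negP=> vN; have [vD nbv] := dom v vN'.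
    case/closed_nbhP: (vN) => [vD'|[d dD edv]]; first by rewrite vD' in vD.
    case/closed_nbhP: (uN) => [uD'|[d' dD' edu]]; first by rewrite uD' in uD.
    move: e'uv; rewrite /e' /= euv /=.
    by case: (nbv d dD edv) => -[? ?]; case: (nbu d' dD' edu) => -[? ?]; subst;
      rewrite ?eqxx ?orbT // e_irr in euv *.
  case/closed_nbhP: (uN) => [uD'|[d dD edu]]; first by rewrite uD' in uD.
  have [[da ub]|[db ua]] := nbu d dD edu; [left|right]; subst; split=> //;
    try (by exists v); move=> d' dD' ed'; case: (nbu d' dD' ed') => -[] // ? ?;
    by subst; rewrite e_irr in eab.
have: ~~ isolating e' D'.
  apply/negP=> /iota_num_le; rewrite card_imset; last exact: Some_inj.
  by rewrite cardD leqNgt lt_iota.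
(* An uncovered edge at the new vertex puts [a] and [b] outside [D], so [u] lost no dominator and
   was undominated in [e]. *)
have half u : (u == a) || (u == b) -> Some u \notin closed_nbh e' D' ->
    None \notin closed_nbh e' D' ->
    [/\ a \notin D, b \notin D &
        a \notin closed_nbh e D \/ b \notin closed_nbh e D].
  move=> uab uN' nN'.
  have aD : a \notin D.
    apply: contra nN' => aD; apply/closed_nbhP; right.
    by exists (Some a); rewrite ?D'E //= eqxx.
  have bD : b \notin D.
    apply: contra nN' => bD; apply/closed_nbhP; right.
    by exists (Some b); rewrite ?D'E //= eqxx orbT.
  have uN : u \notin closed_nbh e D.
    apply/negP=> uN; have [uD nbu] := dom u uN'.
    case/closed_nbhP: (uN) => [uD'|[d dD edu]]; first by rewrite uD' in uD.
    by case: (nbu d dD edu) => -[? _]; subst; rewrite dD in aD bD.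
  by split=> //; case/orP: uab uN => /eqP->; [left|right].
case/forallPn=> -[u|] /forallPn[[v|]] ; rewrite negb_imply negbK.
- case/andP=> /andP[uN vN] e'uv; have /andP[euv _] := e'uv.
  have [uD|uD] := boolP (u \in closed_nbh e D).
    by case: (main u v euv e'uv uN vN uD); [constructor 2|constructor 3].
  have vD : v \in closed_nbh e D by move/isolatingP: isoD => /(_ u v euv); exact.
  rewrite e'_sym in e'uv; rewrite e_sym in euv.
  by case: (main v u euv e'uv vN uN vD); [constructor 2|constructor 3].
- by case/andP=> /andP[uN nN] uab; constructor 1; exact: (half u).
- by case/andP=> /andP[nN vN] vab; constructor 1; exact: (half v).
- by rewrite andbF.
Qed.

Lemma has_nbr (x : T) : exists y, e x y.
Proof.
have [[a [b eab]] _] := e_crit; have [_ conn] := e_conn.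
have [->|xa] := eqVneq x a; first by exists b.
case/connectP: (conn x a) xa => -[|y p] /=; last by case/andP; exists y.
by move=> _ ->; rewrite eqxx.
Qed.

(* If [b] were the only neighbour of [a], exchanging [a] for [b] would give
   another minimum isolating set, for which the leaf [a] has no private
   neighbour. *)
Lemma critical_deg2 (D : {set T}) (a : T) :
  min_isolating e D -> a \in D -> forall b, exists2 c, e a c & c != b.
Proof.
move=> [isoD cardD] aD b0.
have [/existsP[c /andP[eac cb]]|none] := boolP [exists c, e a c && (c != b0)].
  by exists c.
have only c : e a c -> c = b0.
  move=> eac; apply/eqP; apply: contraNT none => cb.
  by apply/existsP; exists c; rewrite eac.
have [b eab] := has_nbr a; have bb := only b eab; subst b0; exfalso.
pose D' := b |: D :\ a.
(* As [b] is the only neighbour of [a], all that [a] dominates is [a] and [b], and [b] dominates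
   both. *)
have sub v : v \in closed_nbh e D -> v \in closed_nbh e D'.
  case/closed_nbhP=> [vD|[d dD edv]]; apply/closed_nbhP.
    have [->|va] := eqVneq v a; last by left; rewrite !inE va vD orbT.
    by right; exists b; rewrite ?inE ?eqxx // e_sym.
  have [da|da] := eqVneq d a; last by right; exists d; rewrite // !inE da dD orbT.
  by left; rewrite (only v) ?inE ?eqxx // -da.
have isoD' : isolating e D'.
  apply/isolatingP=> u v euv uN; apply/sub.
  by move/isolatingP: isoD => /(_ u v euv); apply; apply: contra uN; exact: sub.
have minD' : min_isolating e D'.
  (* If [b] already lay in [D], the set would shrink; so only [#|D'| <= #|D|] is counted, and
     minimality gives the converse. *)
  split=> //; apply/eqP; rewrite eqn_leq iota_num_le // andbT -cardD.
  by rewrite cardsU1 (cardsD1 a D) aD leq_add2r; case: (_ \notin _).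
have bD' : b \in D' by rewrite !inE eqxx.
have aD' : a \notin D' by rewrite !inE eqxx orbF nbr_neq.
have eba : e b a by rewrite e_sym.
case: (critical_edge minD' eba) => [[]|[_ _ _ [c eac]]|[]]; rewrite ?bD' ?(negPf aD') //.
by rewrite (only c eac) => /closed_nbhP[]; left.
Qed.

End Critical.

(** * The status labelling of a critical tree *)

Section Labelling.
Variables (T : finType) (e : rel T).

Definition labelled_edge (s t : status) : Prop :=
  match s, t with
  | stA, stB | stB, stA | stB, stC | stC, stB => True
  | _, _ => False
  end.

(* The non-recursive description of the trees built by the three operations. *)
Record labelling (st : T -> status) : Prop := Labelling {
  label_edge : forall u v, e u v -> labelled_edge (st u) (st v);
  labelA_deg2 : forall a b, st a = stA -> exists2 c, e a c & c != b;
  labelB_A : forall b, st b = stB -> exists2 a, e b a & st a = stA;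
  labelB_A_unique : forall b a a', st b = stB -> e b a -> e b a' ->
    st a = stA -> st a' = stA -> a = a';
  labelB_C : forall b, st b = stB -> exists2 c, e b c & st c = stC
}.

Lemma critical_labelling : is_tree e -> critical e ->
  exists2 st, labelling st & exists a, st a = stA.
Proof.
case=> e_sym e_irr e_conn _ e_crit.
have [D minD] := min_isolating_exists e; have [isoD _] := minD.
have cases := critical_edge e_sym e_irr e_crit minD.
pose st v := if v \in D then stA else if v \in closed_nbh e D then stB else stC.
have stA_D v : st v = stA -> v \in D by rewrite /st; case: ifP => // _; case: ifP.
have stB_D v : st v = stB -> v \notin D /\ exists2 a, a \in D & e a v.
  rewrite /st; case: ifP => // vD; case: ifP => // /closed_nbhP[|//].
  by rewrite vD.
have D_stA v : v \in D -> st v = stA by rewrite /st => ->.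
have stC_N v : v \notin closed_nbh e D -> st v = stC.
  rewrite /st => vN; rewrite (negPf vN); case: ifP => // vD.
  by case/closed_nbhP: vN; left.
have pairB a b : private_pair e D a b -> e a b -> st b = stB.
  case=> aD bD _ _ eab; rewrite /st (negPf bD).
  by case: closed_nbhP => // -[]; right; exists a.
(* With [a] in [D] and [b] outside it, only the second case of [critical_edge] is possible. *)
have pair b : st b = stB -> exists2 a, e a b & private_pair e D a b.
  case/stB_D=> bD [a aD eab]; exists a => //.
  by case: (cases a b eab) => // [[]|[]]; rewrite ?aD // (negPf bD).
exists st; last first.
  have [[a [b eab]] _] := e_crit.
  by have [d dD] := isolating_not_set0 isoD eab; exists d; apply: D_stA.
split.
(* With neither end in [D], one end is undominated, and isolation makes the other dominated: a B-C
   edge. Private pairs give A-B edges. *)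
- move=> u v euv; case: (cases u v euv) => [[uD vD N]|P|P].
  + rewrite /st (negPf uD) (negPf vD).
    case: N => N; rewrite (negPf N); last first.
      move/isolatingP: isoD => /(_ u v euv).
      by case: ifP => // _; rewrite (negPf N) => /(_ isT).
    by move/isolatingP: isoD => /(_ u v euv N) ->.
  + by have [uD _ _ _] := P; rewrite (D_stA u uD) (pairB u v).
  + by have [vD _ _ _] := P; rewrite (D_stA v vD) (pairB v u) // e_sym.
- by move=> a b /stA_D aD; exact: (critical_deg2 e_sym e_irr e_conn e_crit minD).
- by move=> b /pair[a eab [aD _ _ _]]; exists a; [rewrite e_sym | exact: D_stA].
- move=> b a a' /pair[a0 _ [_ _ uniq_a _]] eba eba' /stA_D aD /stA_D aD'.
  by rewrite (uniq_a a) 1?(uniq_a a') // e_sym.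
- by move=> b /pair[a _ [_ _ _ [c ebc cN]]]; exists c => //; exact: stC_N.
Qed.

End Labelling.

(** * Paths hanging off a connected set in an acyclic graph *)

Section Growing.
Variables (T : finType) (e : rel T).
Hypotheses (e_sym : symmetric e) (e_irr : irreflexive e).
Hypothesis e_acyclic : acyclic_graph e.

Definition connected_in (S : {set T}) : Prop :=
  forall x y, x \in S -> y \in S ->
    exists p, [/\ path e x p, last x p = y & all (mem S) p].

(** Two distinct such neighbours would close a cycle through [y] with a simple path inside [S]. *)
Lemma outside_nbr_unique (S : {set T}) y p q :
  connected_in S -> y \notin S -> p \in S -> q \in S -> e y p -> e y q -> p = q.
Proof.
move=> conn yS pS qS eyp eyq; apply/eqP/negPn/negP => pq.
have [s [ps sq sS]] := conn p q pS qS.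
case/shortenP: ps sq => s' ps' us' sub sq.
have: ~~ cycle e (y :: p :: s').
  apply: e_acyclic.
    rewrite cons_uniq us' andbT inE negb_or; apply/andP; split.
      by apply: contraNneq yS => ->.
    by apply: contra yS => /sub /(allP sS).
  by case: s' sq {ps' us' sub} => //= pq'; rewrite pq' eqxx in pq.
by rewrite /= rcons_path eyp ps' sq e_sym eyq.
Qed.

Lemma connected_in_setU1 (S : {set T}) x y :
  connected_in S -> x \in S -> e x y -> connected_in (y |: S).
Proof.
move=> conn xS exy.
have toS p : all (mem S) p -> all (mem (y |: S)) p.
  by apply: sub_all => z zS /=; rewrite in_setU1 [z \in S]zS orbT.
have yS' : y \in y |: S by rewrite setU11.
have xS' : x \in y |: S by rewrite in_setU1 xS orbT.
move=> u v; rewrite !in_setU1 => /orP[/eqP->|uS] /orP[/eqP->|vS].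
- by exists [::].
- have [p [xp pv pS]] := conn x v xS vS; exists (x :: p).
  by rewrite /= e_sym exy xp xS' toS.
- have [p [up px pS]] := conn u x uS xS; exists (rcons p y).
  by rewrite rcons_path last_rcons up px exy all_rcons /= yS' toS.
- by have [p [up pv pS]] := conn u v uS vS; exists p; rewrite toS.
Qed.

(** The arguments [x] and [y] are the last two vertices visited. Only an immediate return is
    forbidden; along a walk in a simple acyclic graph this excludes every repetition. *)
Fixpoint non_backtracking (x y : T) (p : seq T) : bool :=
  if p is z :: p' then (z != x) && non_backtracking y z p' else true.

(* [p] hangs off [S] exactly as in [attach_path], at the vertex [x]. *)
Record hangs_off (S : {set T}) (x : T) (p : seq T) : Prop := HangsOff {
  hang_uniq : uniq p;
  hang_disjoint : forall v, v \in p -> v \notin S;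
  hang_root : forall s i, s \in S -> i < size p ->
    e s (nth x p i) = (s == x) && (i == 0);
  hang_path : forall i j, i < size p -> j < size p ->
    e (nth x p i) (nth x p j) = (i.+1 == j) || (j.+1 == i);
  hang_connected : connected_in (S :|: [set:: p])
}.

(** Induction on the walk, absorbing [y] into [S]. The next vertex [z] is again outside, because [x]
    is the only neighbour of [y] in [S] and the walk does not turn back to it. *)
Lemma non_backtracking_hangs_off (S : {set T}) x y p :
  connected_in S -> x \in S -> y \notin S -> path e x (y :: p) ->
  non_backtracking x y p -> hangs_off S x (y :: p).
Proof.
elim: p x y S => [|z p IHp] x y S conn xS yS /= /andP[exy pathp] nb.
  have root s : s \in S -> e s y = (s == x).
    move=> sS; apply/idP/eqP => [esy|-> //].
    by apply: (outside_nbr_unique conn yS) => //; rewrite e_sym.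
  split=> //.
  - by move=> v; rewrite inE => /eqP->.
  - by move=> s [|i] //= sS _; rewrite root // andbT.
  - by move=> [|i] [|j] //= _ _; rewrite e_irr.
  - suff -> : S :|: [set:: [:: y]] = y |: S by exact: (connected_in_setU1 conn xS).
    by apply/setP=> v; rewrite !inE orbC.
have root s : s \in S -> e s y = (s == x).
  move=> sS; apply/idP/eqP => [esy|-> //].
  by apply: (outside_nbr_unique conn yS) => //; rewrite e_sym.
case/andP: nb => zx nb; case/andP: (pathp) => eyz _.
have zS : z \notin y |: S.
  rewrite in_setU1 negb_or; apply/andP; split.
    by apply: contraTneq eyz => ->; rewrite e_irr.
  by apply: contra zx => zS; rewrite -(root z zS) e_sym.
have conn' := connected_in_setU1 conn xS exy.
have [up disj rootp pathp' connp] := IHp y z _ conn' (setU11 _ _) zS pathp nb.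
have toS v : v \in S -> v \in y |: S by move=> vS; rewrite in_setU1 vS orbT.
(* The induction hypothesis reads positions with default [y] instead of [x]; within range they
   agree. *)
have dflt i : i < size (z :: p) -> nth x (z :: p) i = nth y (z :: p) i.
  exact: set_nth_default.
split.
- rewrite cons_uniq up andbT; apply/negP=> /disj.
  by rewrite setU11.
- move=> v; rewrite inE => /orP[/eqP-> //|/disj]; apply: contra; exact: toS.
- move=> s [|i] sS; first by rewrite /= root // andbT.
  rewrite /= andbF ltnS => ip; rewrite -[nth x _ _]/(nth x (z :: p) i) dflt //.
  by rewrite rootp ?toS //; case: eqP yS sS => // ->; case: (y \in S).
- move=> [|i] [|j] => [_ _|_ jp|ip _|ip jp]; rewrite /= ?e_irr //.
  + by rewrite -[nth x _ _]/(nth x (z :: p) j) dflt // rootp ?setU11 // eqxx orbF.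
  + rewrite e_sym -[nth x _ _]/(nth x (z :: p) i) dflt // rootp ?setU11 // eqxx.
    by [].
  + rewrite -[nth x _ i]/(nth x (z :: p) i) -[nth x _ j]/(nth x (z :: p) j).
    by rewrite !dflt // pathp'.
- suff -> : S :|: [set:: y :: z :: p] = y |: S :|: [set:: z :: p] by [].
  by apply/setP=> v; rewrite !inE orbA [(v \in S) || _]orbC.
Qed.

(** * Growing built subtrees inside a labelled tree *)

Variable st : T -> status.

(* Embedding built graphs into [e] avoids subtypes of [T] during the growth. *)
Definition built_on (S : {set T}) : Prop :=
  exists (U : finType) (eU : rel U) (stU : U -> status) (f : U -> T),
    [/\ built eU stU, injective f, S = f @: setT,
        forall u v, e (f u) (f v) = eU u v & forall u, st (f u) = stU u].

(** The operation enters as a hypothesis on [attach_path], so one argument serves all three. The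
    embedding is extended by sending the [i]-th new vertex to the [i]-th vertex of [p]. *)
Lemma built_on_attach (S : {set T}) x p (s : seq status) :
  hangs_off S x p -> x \in S -> map st p = s ->
  (forall (U : finType) (eU : rel U) (stU : U -> status) (u : U),
     built eU stU -> stU u = st x ->
     built (@attach_path U eU (size p) u) (@attach_status U stU (size p) s)) ->
  built_on S -> built_on (S :|: [set:: p]).
Proof.
move=> [up disj root pathp _] xS sp step [U [eU [stU [f [bU fI SE fE stE]]]]].
have fS u : f u \in S by rewrite SE imset_f.
move: (xS); rewrite {1}SE => /imsetP[u0 _ xE].
pose g (q : U + 'I_(size p)) := match q with inl u => f u | inr i => nth x p i end.
exists (U + 'I_(size p))%type, (@attach_path U eU (size p) u0),
  (@attach_status U stU (size p) s), g; split.
- by apply: step; rewrite // xE stE.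
- move=> [u|i] [v|j] /= => [/fI->|E|E|/eqP] //.
  + by have := disj _ (mem_nth x (ltn_ord j)); rewrite -E fS.
  + by have := disj _ (mem_nth x (ltn_ord i)); rewrite E fS.
  + by rewrite nth_uniq // => /eqP /val_inj ->.
- apply/setP=> v; rewrite !inE; apply/orP/imsetP.
    case=> [|vp]; first by rewrite SE => /imsetP[u _ ->]; exists (inl u).
    have ip : index v p < size p by rewrite index_mem.
    by exists (inr (Ordinal ip)); rewrite ?inE //= nth_index.
  by case=> -[u|i] _ ->; [left; exact: fS | right; exact: mem_nth].
- move=> [u|i] [v|j] /=; first exact: fE.
  + by rewrite root // xE (inj_eq fI).
  + by rewrite e_sym root // xE (inj_eq fI).
  + exact: pathp.
- by case=> [u|i] /=; [exact: stE | rewrite -sp (nth_map x)].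
Qed.

Hypothesis lab : labelling e st.

Lemma nbrA a b : e a b -> st a = stA -> st b = stB.
Proof. by move/(label_edge lab) => + sa; rewrite sa; case: (st b). Qed.

Lemma nbrC c b : e c b -> st c = stC -> st b = stB.
Proof. by move/(label_edge lab) => + sc; rewrite sc; case: (st b). Qed.

Lemma status_neq u v : st u <> st v -> u != v.
Proof. by move=> suv; apply/eqP => uv; rewrite uv in suv. Qed.

(** The closure condition ensures that a vertex newly reached from a B of [S] is a C, as [O1]
    requires. *)
Definition grown (S : {set T}) : Prop :=
  [/\ built_on S, connected_in S
    & forall a b, b \in S -> st b = stB -> e b a -> st a = stA -> a \in S].

Lemma grown_start a : st a = stA -> exists2 S, grown S & a \in S.
Proof.
move=> sa.
have [b1 eab1 _] := labelA_deg2 lab a sa; have sb1 := nbrA eab1 sa.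
have [b2 eab2 b21] := labelA_deg2 lab b1 sa; have sb2 := nbrA eab2 sa.
have [c1 ebc1 sc1] := labelB_C lab sb1; have [c2 ebc2 sc2] := labelB_C lab sb2.
have c1S : connected_in [set c1].
  by move=> u v /set1P-> /set1P->; exists [::].
(* The [P5] is [c1 b1 a b2 c2]: its last four vertices hang off the singleton of the first. *)
have h : hangs_off [set c1] c1 [:: b1; a; b2; c2].
  apply: non_backtracking_hangs_off; rewrite ?inE //=.
  - by apply: status_neq; rewrite sb1 sc1.
  - by rewrite e_sym ebc1 e_sym eab1 eab2 ebc2.
  - by rewrite b21 !status_neq // ?sa ?sc1 ?sc2.
have [up disj root pathp conn] := h.
exists ([set c1] :|: [set:: [:: b1; a; b2; c2]]); last first.
  by rewrite !inE eqxx !orbT.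
split=> //; last first.
  move=> a' b; rewrite !inE => /or4P[/eqP->|/eqP->|/eqP->|/orP[]/eqP->] sb eba' sa'.
  - by rewrite sb in sc1.
  - by rewrite (labelB_A_unique lab sb eba' _ sa' sa) ?eqxx ?orbT // e_sym.
  - by rewrite sb in sa.
  - by rewrite (labelB_A_unique lab sb eba' _ sa' sa) ?eqxx ?orbT // e_sym.
  - by rewrite sb in sc2.
have ndis v : v \in [:: b1; a; b2; c2] -> v != c1 by move/disj; rewrite inE.
pose q := [:: c1; b1; a; b2; c2].
exists 'I_5, (@path_graph 5),
  (fun i : 'I_5 => nth stC [:: stC; stB; stA; stB; stC] i), (fun i : 'I_5 => nth c1 q i).
split.
- exact: built_P5.
- move=> i j /eqP; rewrite nth_uniq //; first by move/eqP/val_inj.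
  by rewrite cons_uniq up andbT; apply/negP=> /ndis; rewrite eqxx.
- apply/setP=> v; transitivity (v \in q); first by rewrite !inE.
  apply/idP/imsetP => [vq|[i _ ->]]; last exact: mem_nth.
  have iq : index v q < 5 by rewrite (index_mem v q).
  by exists (Ordinal iq); rewrite ?inE //= nth_index.
- move=> [[|i] ip] [[|j] jp]; rewrite /path_graph /=.
  + by rewrite e_irr.
  + by rewrite root ?set11 // eqxx orbF.
  + by rewrite e_sym root ?set11 // eqxx.
  + exact: pathp.
- by case=> [[|[|[|[|[|i]]]]]].
Qed.

Lemma grown_step (S : {set T}) x y :
  grown S -> x \in S -> y \notin S -> e x y -> exists2 S', grown S' & S \proper S'.
Proof.
move=> [bS conn closedS] xS yS exy.
have proper p : y \in p -> S \proper S :|: [set:: p].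
  move=> yp; apply/properP; split; first exact: subsetUl.
  by exists y; rewrite // !inE yp orbT.
have eyx : e y x by rewrite e_sym.
(* The status of [x] selects the operation: A gives [O2], B gives [O1], C gives [O3]. *)
case sx: (st x).
- have sy := nbrA exy sx; have [z eyz sz] := labelB_C lab sy.
  have h : hangs_off S x [:: y; z].
    apply: non_backtracking_hangs_off => //=; first by rewrite exy eyz.
    by rewrite status_neq // sx sz.
  exists (S :|: [set:: [:: y; z]]); last by apply: proper; rewrite inE eqxx.
  split; last 1 first.
  + move=> a b; rewrite !inE => /or3P[bS'|/eqP->|/eqP->] sb eba sa.
    * by rewrite (closedS a b).
    * by rewrite (labelB_A_unique lab sb eba eyx sa sx) xS.
    * by rewrite sb in sz.
  + apply: (@built_on_attach S x [:: y; z] [:: stB; stC] h) => //=.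
      by rewrite sy sz.
    by move=> U eU stU u bU su; apply: built_O2; rewrite // su.
  + by case: h.
- case sy: (st y).
  + by rewrite (closedS y x) in yS.
  + by have := label_edge lab exy; rewrite sx sy.
  have h : hangs_off S x [:: y].
    by apply: non_backtracking_hangs_off => //=; rewrite exy.
  exists (S :|: [set:: [:: y]]); last by apply: proper; rewrite inE eqxx.
  split; last 1 first.
  + move=> a b; rewrite !inE => /orP[bS'|/eqP->] sb eba sa.
      by rewrite (closedS a b).
    by rewrite sb in sy.
  + apply: (@built_on_attach S x [:: y] [:: stC] h) => //=; first by rewrite sy.
    by move=> U eU stU u bU su; apply: built_O1; rewrite // su.
  + by case: h.
(* The walk [x y v w z] never turns back, so the four vertices demanded by the labelling all lie
   outside [S]. *)
- have sy := nbrC exy sx; have [v eyv sv] := labelB_A lab sy.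
  have [w evw wy] := labelA_deg2 lab y sv; have sw := nbrA evw sv.
  have [z ewz sz] := labelB_C lab sw.
  have h : hangs_off S x [:: y; v; w; z].
    apply: non_backtracking_hangs_off => //=; first by rewrite exy eyv evw ewz.
    by rewrite wy !status_neq // ?sv ?sx ?sz.
  exists (S :|: [set:: [:: y; v; w; z]]); last by apply: proper; rewrite inE eqxx.
  split; last 1 first.
  + move=> a b; rewrite !inE orbA => /or4P[/orP[bS'|/eqP->]|/eqP->|/eqP->|/eqP->] sb eba sa.
    * by rewrite (closedS a b).
    * by rewrite (labelB_A_unique lab sb eba eyv sa sv) eqxx !orbT.
    * by rewrite sb in sv.
    * by rewrite (labelB_A_unique lab sb eba _ sa sv) ?eqxx ?orbT // e_sym.
    * by rewrite sb in sz.
  + apply: (@built_on_attach S x [:: y; v; w; z] [:: stB; stA; stB; stC] h) => //=.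
      by rewrite sy sv sw sz.
    by move=> U eU stU u bU su; apply: built_O3; rewrite // su.
  + by case: h.
Qed.

Lemma labelling_built :
  connected_graph e -> (exists a, st a = stA) -> built e st.
Proof.
move=> [_ conn] [a sa]; have [S0 gS0 aS0] := grown_start sa.
have grow n S : #|~: S| <= n -> a \in S -> grown S -> grown [set: T].
  elim: n S => [|n IHn] S Sn aS gS.
    by move: Sn; rewrite leqn0 cards_eq0 => /eqP SC; rewrite -setC0 -SC setCK.
  have [/existsP[x /existsP[y /and3P[xS yS exy]]]|none] :=
    boolP [exists x, exists y, [&& x \in S, y \notin S & e x y]].
    have [S' gS' ltS] := grown_step gS xS yS exy; apply: (IHn S') => //.
      by rewrite -ltnS (leq_trans _ Sn) // proper_card // properC.
    exact: (subsetP (proper_sub ltS)).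
  (* No edge leaves [S], so connectedness and [a] in [S] give the whole vertex set. *)
  suff -> : [set: T] = S by [].
  have closedS x y : e x y -> (x \in S) = (y \in S).
    have sub u v : e u v -> u \in S -> v \in S.
      move=> euv uS; apply: contraNT none => vS.
      by apply/existsP; exists u; apply/existsP; exists v; rewrite uS vS.
    by move=> exy; apply/idP/idP; apply: sub; rewrite // e_sym.
  by apply/setP=> v; rewrite inE -(closed_connect closedS (conn a v)) aS.
have [[U [eU [stU [f [bU fI SE fE stE]]]]] _ _] := grow _ _ (leqnn _) aS0 gS0.
apply: (built_iso bU _ fE stE).
have surj v : v \in codom f.
  have: v \in [set: T] by rewrite inE.
  by rewrite SE => /imsetP[u _ ->]; exact: codom_f.
by exists (fun v => iinv (surj v)) => [u|v]; [apply: fI|]; rewrite f_iinv.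
Qed.

End Growing.

Theorem theorem4p9 (T : finType) (e : rel T) :
  is_tree e -> critical e -> family_iota e.
Proof.
move=> e_tree e_crit; have [st lab exA] := critical_labelling e_tree e_crit.
have [e_sym e_irr e_conn e_acyclic] := e_tree.
by exists st; exact: (labelling_built e_sym e_irr e_acyclic lab e_conn exA).
Qed.
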